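(* Let $\delta>0$ and let $\{a_n\}_{n=1}^\infty$ be a sequence of complex numbers satisfying $a_n\ll n^{1-\delta}$. Let $f(s)=\sum_{n=1}^\infty a_n n^{-s}$. Let $a$ and $b$ be positive integers, and for each positive integer $n$ let $H_n^{(a,b)}[f]=\det_{1\le i,j\le n}\bigl(f(a(i+j)+b)\bigr)$. Then, as $n\to\infty$, $$\log |H_n^{(a,b)}[f]|\le -\frac a2 n^2\log n+O\big(n^2\big).$$
   Context: The condition $a_n\ll n^{1-\delta}$ means that there is a constant $C>0$ with $|a_n|\le C n^{1-\delta}$ for all $n\ge1$. The Dirichlet series $f(s)$ then converges absolutely for $\operatorname{Re}(s)>2-\delta$, so $f(m)$ is defined for every integer $m\ge2$. The integer $a$ is unrelated to the coefficients $a_n$. The conclusion means that there are constants $K$ and $N$ (possibly depending on the sequence $\{a_n\}$, $\delta$, $a$ and $b$) such that $\log|H_n^{(a,b)}[f]|\le-\frac a2 n^2\log n+Kn^2$ for all $n\ge N$, with the convention $\log 0=-\infty$ (i.e. the inequality holds trivially when $H_n^{(a,b)}[f]=0$). *)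

(* Defs.v *)
From HB Require Import structures.
From mathcomp Require Import all_boot all_order all_algebra.
From mathcomp Require Import all_classical all_reals all_analysis.
From mathcomp Require Import complex.

Set Implicit Arguments.
Unset Strict Implicit.
Unset Printing Implicit Defensive.

Import Order.TTheory GRing.Theory Num.Theory.
Import numFieldNormedType.Exports.

Local Open Scope ring_scope.
Local Open Scope complex_scope.

Definition cexp (R : realType) (z : R[i]) : R[i] :=
  (expR (complex.Re z))%:C * (cos (complex.Im z) +i* sin (complex.Im z)).

(* k ^ (- s) = exp (- s log k); only meaningful for k >= 1. *)
Definition nat_cpowN (R : realType) (k : nat) (s : R[i]) : R[i] :=
  cexp (- s * (ln (k%:R : R))%:C).

(* The coefficients are indexed from 1 (u 0 is ignored). The sum is the limit
   of the partial sums, a default value where they diverge. R[i]^o is R[i] with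
   the topology of its norm, which is not inferred for R[i] itself. *)
Definition dirichlet (R : realType) (u : nat -> R[i]) (s : R[i]) : R[i] :=
  limn (fun n : nat => \sum_(1 <= k < n.+1) u k * nat_cpowN k s : R[i]^o).

(* The ordinals i, j : 'I_n are 0-based, the row and column indices of the
   determinant are i.+1 and j.+1. *)
Definition hankel_det (R : realType) (f : R[i] -> R[i]) (a b n : nat) : R[i] :=
  \det (\matrix_(i < n, j < n) f ((a * (i.+1 + j.+1) + b)%N%:R)).

(* Main.v *)
(* The Hankel matrix of the partial sums of f is a product A *m B with
   A i k = w_k x_k^i and B k j = x_k^j, where x_k = (k+1)^-a and the weights
   |w_k| = O(k^-2) are summable. Expanding the determinant over the maps
   i |-> k_i reduces it to Vandermonde determinants in the x_(k_i). Each one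
   vanishes unless the k_i are distinct; sorting them increasingly gives k_i >= i,
   so every factor x_(k_j) - x_(k_i) with i < j is at most (i+1)^-a. The product of
   these bounds over all pairs has logarithm -a (n^2/2) log n + O(n^2), while the
   powers of x_k in A, which are at most 1, and the sum over the maps cost only a
   factor C^n. The bound is uniform in the number of terms of the partial sums,
   and passes to the limit. *)
Require Import Defs.
From HB Require Import structures.
From mathcomp Require Import all_boot all_order all_algebra.
From mathcomp Require Import all_classical all_reals all_analysis.
From mathcomp Require Import complex.
From mathcomp Require Import perm zify ring lra.
Import Order.TTheory GRing.Theory Num.Theory.
Import numFieldNormedType.Exports.
Local Open Scope ring_scope.

Set Implicit Arguments.
Unset Strict Implicit.

(** * Determinants of moment matrices, and the summability of the weights *)

(** Cauchy-Binet before the maps are grouped by their image: each entry of the product is a sum over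
    [k], and distributing the product over rows picks one [k] per row. *)
Lemma det_mulmx_ffun (R : comPzRingType) (n m : nat)
    (A : 'M[R]_(n, m)) (B : 'M[R]_(m, n)) :
  \det (A *m B) =
  \sum_(f : {ffun 'I_n -> 'I_m}) (\prod_i A i (f i)) * \det (rowsub f B).
Proof.
rewrite /determinant.
under eq_bigr => s _.
  rewrite (eq_bigr (fun i => \sum_k A i k * B k (s i))); last first.
    by move=> i _; rewrite mxE.
  rewrite bigA_distr_bigA big_distrr /=; over.
rewrite exchange_big /=; apply: eq_bigr => f _.
rewrite big_distrr /=; apply: eq_bigr => s _.
rewrite big_split /= mulrCA; congr (_ * (_ * _)).
by apply: eq_bigr => i _; rewrite mxE.
Qed.

(** The permutation is the one that sorts the tuple of values; injectivity makes the sorted tuple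
    strictly increasing. *)
Lemma inj_perm_increasing (n : nat) (f : 'I_n -> nat) : injective f ->
  exists s : 'S_n, {homo (fun i => f (s i)) : i j / (i < j)%N}.
Proof.
move=> f_inj; pose t := [tuple f i | i < n].
have /tuple_permP[s ts] : perm_eq (sort leq t) t by rewrite perm_sort.
exists s => i j lt_ij.
have st : sorted ltn (sort leq t).
  rewrite ltn_sorted_uniq_leq sort_uniq (sort_sorted leq_total) andbT.
  by rewrite map_inj_uniq ?enum_uniq.
have fE k : f (s k) = nth 0%N (sort leq t) k.
  by rewrite ts -(tnth_nth 0%N) !tnth_mktuple.
have szt : size (sort leq t) = n by rewrite size_sort size_tuple.
by rewrite !fE (sorted_ltn_nth ltn_trans) // inE szt.
Qed.

Lemma leq_increasing_ord (n : nat) (f : 'I_n -> nat) :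
  {homo f : i j / (i < j)%N} -> forall i : 'I_n, (i <= f i)%N.
Proof.
move=> f_incr [i +]; elim: i => // i IHi lt_in /=.
have := f_incr (Ordinal (ltnW lt_in)) (Ordinal lt_in) (ltnSn i).
exact/leq_ltn_trans/IHi.
Qed.

Lemma norm_det_row_perm (F : numDomainType) (n : nat) (s : 'S_n) (A : 'M[F]_n) :
  `|\det (row_perm s A)| = `|\det A|.
Proof.
by rewrite row_permE det_mulmx det_perm normrM normrX normrN1 expr1n mul1r.
Qed.

Lemma norm_det_powers_le (F : numFieldType) (n : nat) (x : nat -> F)
    (f : 'I_n -> nat) :
    (forall k, 0 <= x k) -> {homo x : k l / (k <= l)%N >-> l <= k} ->
  `|\det (\matrix_(i < n, j < n) x (f i) ^+ j)|
    <= \prod_(i < n) \prod_(j < n | (i < j)%N) x i.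
Proof.
move=> x_ge0 x_decr.
have rhs_ge0 : 0 <= \prod_(i < n) \prod_(j < n | (i < j)%N) x i.
  by apply: prodr_ge0 => i _; apply: prodr_ge0.
have [/injectiveP f_inj|/injectivePn[i [j neq_ij fij]]] :=
  boolP (injectiveb f); last first.
  (* A repeated value of [f] gives two equal rows. *)
  rewrite (determinant_alternate neq_ij) ?normr0// => k.
  by rewrite !mxE fij.
have [s s_incr] := inj_perm_increasing f_inj.
rewrite -(norm_det_row_perm s) -det_tr.
have -> : (row_perm s (\matrix_(i < n, j < n) x (f i) ^+ j))^T =
    Vandermonde n (\row_i x (f (s i))) by apply/matrixP => i j; rewrite !mxE.
rewrite det_Vandermonde normr_prod; apply: ler_prod => i _.
rewrite normr_ge0 normr_prod; apply: ler_prod => j lt_ij.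
rewrite normr_ge0 !mxE distrC ger0_norm; last first.
  by rewrite subr_ge0 x_decr // ltnW // s_incr.
(* Dropping the subtracted nonnegative term leaves [x (f (s i))], at most [x i] because
   [i <= f (s i)]. *)
rewrite (le_trans _ (x_decr _ _ (leq_increasing_ord s_incr i))) //.
by rewrite lerBlDr lerDl.
Qed.

Lemma norm_det_moments_le (F : numFieldType) (n m : nat) (w x : nat -> F) (S : F) :
    (forall k, 0 <= x k) -> (forall k, x k <= 1) ->
    {homo x : k l / (k <= l)%N >-> l <= k} ->
    \sum_(k < m) `|w k| <= S ->
  `|\det (\matrix_(i < n, j < n) \sum_(k < m) w k * x k ^+ (i + j))|
    <= S ^+ n * \prod_(i < n) \prod_(j < n | (i < j)%N) x i.
Proof.
move=> x_ge0 x_le1 x_decr wS.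
set V := \prod_(i < n) _.
have V_ge0 : 0 <= V by apply: prodr_ge0 => i _; apply: prodr_ge0.
pose A := \matrix_(i < n, k < m) (w k * x k ^+ i).
pose B := \matrix_(k < m, j < n) (x k ^+ j).
have -> : \matrix_(i < n, j < n) (\sum_(k < m) w k * x k ^+ (i + j)) = A *m B.
  apply/matrixP => i j; rewrite !mxE; apply: eq_bigr => k _.
  by rewrite !mxE exprD mulrA.
rewrite det_mulmx_ffun (le_trans (ler_norm_sum _ _ _)) //.
apply: (@le_trans _ _ ((\sum_(f : {ffun 'I_n -> 'I_m}) \prod_i `|A i (f i)|) * V)).
  rewrite mulr_suml; apply: ler_sum => f _.
  rewrite normrM normr_prod ler_wpM2l ?prodr_ge0//.
  rewrite (_ : rowsub f B = \matrix_(i, j) x (f i) ^+ j); last first.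
    by apply/matrixP => i j; rewrite !mxE.
  exact: (norm_det_powers_le (fun i => f i : nat)).
(* Distributivity read backwards: the sum over all maps is a product of [n] row sums, each at most
   [S] since [x k ^+ i <= 1]. *)
rewrite ler_wpM2r// -(bigA_distr_bigA (fun i k => `|A i k|)) /=.
rewrite -[n in S ^+ n]card_ord -prodr_const; apply: ler_prod => i _.
rewrite sumr_ge0//= (le_trans _ wS)//; apply: ler_sum => k _.
rewrite mxE normrM normrX (ger0_norm (x_ge0 k)).
by rewrite ler_piMr// exprn_ile1.
Qed.

Lemma sum_inv_sqr_le (F : numFieldType) (m : nat) :
  \sum_(k < m) (k.+1%:R ^- 2 : F) <= 2.
Proof.
(* Strengthened so that induction telescopes, via [1/(m+2)^2 <= 1/(m+1) - 1/(m+2)]. *)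
suff : \sum_(k < m.+1) (k.+1%:R ^- 2 : F) <= 2 - m.+1%:R^-1.
  rewrite big_ord_recr /= => h; apply: le_trans (le_trans _ h) _.
    by rewrite lerDl invr_ge0 exprn_ge0.
  by rewrite lerBlDr lerDl invr_ge0.
elim: m => [|m IHm]; first by rewrite big_ord1 expr1n invr1; rewrite -[2]/(1 + 1) addrK.
rewrite big_ord_recr /= (le_trans (lerD IHm (lexx _)))//.
rewrite -addrA lerD2l -(addrNK (m.+1%:R * m.+2%:R)^-1 (m.+2%:R ^- 2)) addrCA.
have m1 : m.+1%:R != 0 :> F by rewrite pnatr_eq0.
have m2 : m.+2%:R != 0 :> F by rewrite pnatr_eq0.
have -> : - m.+1%:R^-1 + (m.+1%:R * m.+2%:R)^-1 = - m.+2%:R^-1 :> F.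
  by move: m1 m2; rewrite -[m.+2%:R]natr1; move: m.+1%:R => y y0 y1; field; rewrite y0 y1.
rewrite -[leRHS]add0r lerD2r subr_le0 lef_pV2 ?posrE ?mulr_gt0 ?exprn_gt0 ?ltr0n//.
by rewrite expr2 ler_wpM2r// ler_nat.
Qed.

(** * Limits of determinants and of complex sequences *)

Lemma cvg_det (K : numFieldType) (n : nat) (A : nat -> 'M[K]_n) (B : 'M[K]_n) :
  (forall i j, A m i j @[m --> \oo] --> B i j)%classic ->
  (\det (A m) @[m --> \oo] --> \det B)%classic.
Proof.
move=> AB; apply: cvg_big => [|s _]; first exact: add_continuous.
apply: cvgMl_tmp; apply: cvg_big => [|i _]; [exact: mul_continuous|exact: AB].
Qed.

Lemma cvg_det_complex (R : realType) (n : nat) (A : nat -> 'M[R[i]]_n) (B : 'M[R[i]]_n) :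
  (forall i j, (A m i j : R[i]^o) @[m --> \oo] --> (B i j : R[i]^o))%classic ->
  ((\det (A m) : R[i]^o) @[m --> \oo] --> (\det B : R[i]^o))%classic.
Proof. exact: (@cvg_det (R[i] : numFieldType)). Qed.

Lemma norm_lim_complex_le (R : realType) (z : nat -> R[i]) (l : R[i]) (B : R[i]) :
  ((z m : R[i]^o) @[m --> \oo] --> (l : R[i]^o))%classic ->
  (forall m, `|z m| <= B) -> `|l| <= B.
Proof.
move=> zl zB; have B_ge0 : 0 <= B by apply: le_trans (zB 0%N).
(* The order on [R[i]] is partial; the negation is legitimate because both sides are nonnegative,
   hence real. *)
rewrite real_leNgt ?realE ?normr_ge0 ?B_ge0//; apply/negP => lB.
have [m _ /(_ m (leqnn m))] := cvgr_norm_gt _ zl _ lB.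
by move=> /(le_lt_trans (zB m)); rewrite ltxx.
Qed.

Lemma normr_complex_le (R : rcfType) (z : R[i]) :
  `|z| <= (`|complex.Re z| + `|complex.Im z|)%:C%C.
Proof.
rewrite [z in leLHS]complexE (le_trans (ler_normD _ _))//.
rewrite normrM normCi mul1r rmorphD /=.
by rewrite !normc_def /= !expr0n !addr0 !sqrtr_sqr.
Qed.

Lemma cvg_Re_Im (R : realType) (z : nat -> R[i]) (l : R[i]) :
  (complex.Re (z m) @[m --> \oo] --> complex.Re l)%classic ->
  (complex.Im (z m) @[m --> \oo] --> complex.Im l)%classic ->
  ((z m : R[i]^o) @[m --> \oo] --> (l : R[i]^o))%classic.
Proof.
move=> Rel Iml; apply/cvgrPdist_le => e e_gt0.
(* A positive element of [R[i]] has zero imaginary part. *)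
have [e0 eE] : 0 < complex.Re e /\ e = (complex.Re e)%:C%C.
  by case: e e_gt0 => r s; rewrite ltcE /= => /andP[/eqP -> ->].
have e2 : 0 < complex.Re e / 2 by rewrite divr_gt0.
near=> m; rewrite eE.
have Rem : `|complex.Re l - complex.Re (z m)| <= complex.Re e / 2.
  by near: m; exact: (cvgrPdist_le _ _).1 Rel _ e2.
have Imm : `|complex.Im l - complex.Im (z m)| <= complex.Re e / 2.
  by near: m; exact: (cvgrPdist_le _ _).1 Iml _ e2.
rewrite (le_trans (normr_complex_le _))// lecR (splitr (complex.Re e)).
by move: Rem Imm; case: (l) => x y; case: (z m) => x' y'; apply: lerD.
Unshelve. all: by end_near. Qed.

(** * Lower bounds for sums of logarithms *)

Lemma lnS_sub_le (R : realType) (m : nat) : (0 < m)%N ->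
  ln (m.+1%:R : R) - ln (m%:R : R) <= m%:R^-1.
Proof.
move=> m_gt0; have m0 : 0 < m%:R :> R by rewrite ltr0n.
rewrite -ln_div ?posrE ?ltr0n// -natr1 mulrDl divff ?gt_eqF// mul1r.
by rewrite le_ln1Dx// (@lt_le_trans _ _ 0)// invr_ge0 ltW.
Qed.

(** The weak Stirling bound [m! >= (m/e)^m]. The left side grows by
    [m (ln (m+1) - ln m) + ln (m+1) - 1], at most [ln (m+1)] by [lnS_sub_le]. *)
Lemma sum_ln_ge (R : realType) (m : nat) :
  m%:R * ln m%:R - m%:R <= \sum_(i < m) ln i.+1%:R :> R.
Proof.
elim: m => [|m IHm]; first by rewrite mul0r subr0 big_ord0.
rewrite big_ord_recr /=.
have [->|m_gt0] := posnP m; first by rewrite big_ord0 ln1 mulr0 sub0r addr0 oppr_le0.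
have := lnS_sub_le R m_gt0; rewrite -(ler_pM2l (x := m%:R)) ?ltr0n//.
rewrite divff ?pnatr_eq0 -?lt0n//; move: IHm; rewrite -[m.+1%:R]natr1.
move: (\sum_(i < m) _) (ln _) (ln _) => s l l'; nra.
Qed.

Lemma sum_sum_ln_ge (R : realType) (n : nat) :
  n%:R ^+ 2 / 2 * ln n%:R - 2 * n%:R ^+ 2
    <= \sum_(i < n) \sum_(j < n | (i < j)%N) ln i.+1%:R :> R.
Proof.
(* With [j] outermost the inner sum is [ln j!], so the induction step adds exactly the sum bounded
   by [sum_ln_ge]. *)
rewrite (exchange_big_dep predT)//=.
under eq_bigr => j _ do
  rewrite -(big_ord_widen n (fun i => ln i.+1%:R : R) (ltnW (ltn_ord j))).
elim: n => [|n IHn]; first by rewrite big_ord0 expr0n/= !(mul0r,mulr0) subrr.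
rewrite big_ord_recr /=; have := sum_ln_ge R n.
have [->|n_gt0] := posnP n; first by rewrite !big_ord0 ln1 expr1n; lra.
have n1 : 1 <= n%:R :> R by rewrite ler1n.
have := lnS_sub_le R n_gt0; rewrite -(ler_pM2l (x := n%:R)) ?ltr0n//.
rewrite divff ?pnatr_eq0 -?lt0n//.
have : ln n%:R < n%:R :> R by rewrite ln_sublinear ?ltr0n.
have : ln (n%:R : R) <= ln n.+1%:R by rewrite ler_ln ?posrE ?ltr0n// ler_nat.
move: IHn; rewrite -[n.+1%:R]natr1; move: n%:R n1 => x x1.
move: (\sum_(j < n) _) (\sum_(i < n) _) (ln _) (ln _) => t s l' l IHn ll' lx h ht.
(* The first two groups are covered by [IHn] and [h]; the rest is negative, since
   [x * (l' - l) <= 1], [l' - l <= 1] and [l < x]. *)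
have -> : (x + 1) ^+ 2 / 2 * l' - 2 * (x + 1) ^+ 2 =
  (x ^+ 2 / 2 * l - 2 * x ^+ 2) + (x * l - x) + (x + 2 ^+ 1) / 2 * (x * (l' - l))
   + ((l' - l) + l) / 2 - 3 * x - 2 by field.
have d1 : l' - l <= 1 by nra.
nra.
Qed.

(** * Convergence of the Dirichlet series at integers *)

Lemma cvg_series_dominated (R : realType) (u : nat -> R) (C : R) :
  (forall k, `|u k| <= C * k.+1%:R ^- 2) -> cvgn (series u).
Proof.
move=> uC; apply: normed_cvg; apply: nondecreasing_is_cvgn.
  by apply: nondecreasing_series => k _ _; apply: normr_ge0.
have C_ge0 : 0 <= C by have := uC 0%N; rewrite expr1n invr1 mulr1; apply: le_trans.
exists (C * 2) => _ [m _ <-]; rewrite /normed_series_of seriesEord /=.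
rewrite (le_trans (ler_sum _ (fun (k : 'I_m) _ => uC k)))// -mulr_sumr.
by rewrite ler_wpM2l// sum_inv_sqr_le.
Qed.

Lemma cvg_sum_dominated_complex (R : realType) (z : nat -> R[i]) (C : R) :
  (forall k, `|z k| <= C%:C%C * k.+1%:R ^- 2) ->
  cvgn (fun n => \sum_(k < n) z k : R[i]^o).
Proof.
move=> zC.
have zC' k : Normc.normc (z k) <= C * k.+1%:R ^- 2.
  by rewrite -lecR rmorphM fmorphV rmorphXn rmorph_nat; exact: zC.
have Rez : cvgn (series (fun k => complex.Re (z k))).
  apply: (@cvg_series_dominated _ _ C) => k; apply: le_trans (zC' k).
  by rewrite -lecR; exact: normc_ge_Re.
have Imz : cvgn (series (fun k => complex.Im (z k))).
  apply: (@cvg_series_dominated _ _ C) => k; apply: le_trans (zC' k).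
  by rewrite -lecR -normrN -ReiNIm (le_trans (normc_ge_Re _))// normrM normCi mulr1.
have sumE n : \sum_(k < n) z k =
    (series (fun k => complex.Re (z k)) n +i* series (fun k => complex.Im (z k)) n)%C.
  rewrite /series /= !big_mkord; elim: n => [|n IHn]; first by rewrite !big_ord0.
  by rewrite !big_ord_recr IHn /=; case: (z n).
apply/cvg_ex; exists (limn (series (fun k => complex.Re (z k))) +i*
  limn (series (fun k => complex.Im (z k))))%C.
by apply: cvg_Re_Im; under eq_fun do rewrite sumE /=.
Qed.

Lemma nat_cpowN_nat (R : realType) (k m : nat) : (0 < k)%N ->
  nat_cpowN k m%:R = k%:R ^- m :> R[i].
Proof.
move=> k_gt0; rewrite /nat_cpowN /cexp.
have -> : - m%:R * (ln (k%:R : R))%:C%C = (- (m%:R * ln k%:R))%:C%C :> R[i].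
  by rewrite rmorphN rmorphM rmorph_nat mulNr.
rewrite /= cos0 sin0 mulr1 expRN expRM_natl lnK ?posrE ?ltr0n//.
by rewrite fmorphV rmorphXn rmorph_nat.
Qed.

(** Domination ensures that the [limn] in [dirichlet] is a true limit and not a default value. *)
Lemma cvg_dirichlet_nat (R : realType) (u : nat -> R[i]) (C : R) (m : nat) :
  (forall k, `|u k.+1 * k.+1%:R ^- m| <= C%:C%C * k.+1%:R ^- 2) ->
  ((\sum_(k < n) u k.+1 * k.+1%:R ^- m : R[i]^o) @[n --> \oo] -->
    (dirichlet u m%:R : R[i]^o))%classic.
Proof.
move=> uC; have := cvg_sum_dominated_complex uC.
rewrite /dirichlet.
suff -> : (fun n => \sum_(k < n) u k.+1 * k.+1%:R ^- m : R[i]^o) =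
  (fun n => \sum_(1 <= k < n.+1) u k * nat_cpowN k m%:R) by [].
apply/funext => n; rewrite big_add1 big_mkord.
by apply: eq_bigr => k _; rewrite nat_cpowN_nat.
Qed.

(** Since [n^(1 - delta) <= n], dividing by [n^m] with [m >= 3] leaves at most [C n^-2]. *)
Lemma norm_coef_mul_le (R : realType) (delta C : R) (u : nat -> R[i]) (m : nat) :
    0 <= delta -> 0 <= C ->
    (forall n : nat, (1 <= n)%N -> Normc.normc (u n) <= C * n%:R `^ (1 - delta)) ->
    (3 <= m)%N ->
  forall k, `|u k.+1 * k.+1%:R ^- m| <= C%:C%C * k.+1%:R ^- 2.
Proof.
move=> delta_ge0 C_ge0 uC m_ge3 k.
have k1 : 1 <= k.+1%:R :> R by rewrite ler1n.
have uk : `|u k.+1| <= (C * k.+1%:R)%:C%C.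
  rewrite lecR (le_trans (uC _ _))// ler_wpM2l//.
  by rewrite -[leRHS]powRr1// ler_powR// gerBl.
rewrite normrM (le_trans (ler_wpM2r _ uk))// rmorphM rmorph_nat -mulrA.
rewrite ler_wpM2l ?lecR// normfV normrX normr_nat -(subnKC m_ge3).
rewrite ler_pdivrMr ?exprn_gt0 ?ltr0n// exprD (exprSr _ 2) -(mulrA (_ ^+ 2)).
rewrite mulKf ?expf_neq0 ?pnatr_eq0//.
by rewrite ler_peMr ?exprn_ege1 ?ler1n.
Qed.

(** * The bound for the Hankel determinant *)

Lemma norm_hankel_det_le (R : realType) (u : nat -> R[i]) (C : R) (a b n : nat) :
    (forall m, (3 <= m)%N ->
      forall k, `|u k.+1 * k.+1%:R ^- m| <= C%:C%C * k.+1%:R ^- 2) ->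
    (0 < a)%N -> (0 < b)%N ->
  Normc.normc (hankel_det (dirichlet u) a b n) <=
    (C * 2) ^+ n * \prod_(i < n) \prod_(j < n | (i < j)%N) i.+1%:R ^- a.
Proof.
move=> uC a_gt0 b_gt0; rewrite -lecR.
pose A m := \matrix_(i < n, j < n)
  \sum_(k < m) u k.+1 * k.+1%:R ^- (a * (i.+1 + j.+1) + b).
(* The weight absorbs the exponent [a * 2 + b] of the top left entry, at least 3; what remains is
   [x k ^+ (i + j)] with 0-based indices. *)
pose w k := u k.+1 * k.+1%:R ^- (a * 2 + b).
pose x k : R[i] := k.+1%:R ^- a.
apply: (@norm_lim_complex_le _ (fun m => \det (A m))).
  apply: cvg_det_complex => i j; rewrite mxE; under eq_fun do rewrite mxE.
  by apply: cvg_dirichlet_nat => k; apply: uC; nia.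
move=> m.
have -> : A m = \matrix_(i < n, j < n) \sum_(k < m) w k * x k ^+ (i + j).
  apply/matrixP => i j; rewrite !mxE; apply: eq_bigr => k _.
  rewrite /w /x -mulrA -exprVn -exprVn -exprVn -exprM -exprD; congr (_ * _ ^+ _).
  by lia.
rewrite rmorphM rmorphXn rmorph_prod.
under [X in _ <= _ * X]eq_bigr => i _.
  rewrite rmorph_prod; under eq_bigr => j _ do rewrite fmorphV rmorphXn rmorph_nat.
  over.
apply: (norm_det_moments_le _ _ (x := x)) => [k|k|k l le_kl|].
- by rewrite invr_ge0 exprn_ge0.
- by rewrite invf_le1 ?exprn_gt0 ?ltr0n// exprn_ege1// ler1n.
- by rewrite lef_pV2 ?posrE ?exprn_gt0 ?ltr0n// lerXn2r ?nnegrE// ler_nat.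
have C_ge0 : 0 <= C%:C%C.
  by have := uC 3%N isT 0%N; rewrite !expr1n !invr1 !mulr1; apply: le_trans.
rewrite (le_trans (ler_sum _ (fun (k : 'I_m) _ => uC (a * 2 + b)%N _ k)))//; first by nia.
by rewrite -mulr_sumr rmorphM rmorph_nat ler_wpM2l// sum_inv_sqr_le.
Qed.

Set Strict Implicit.
Unset Implicit Arguments.

Theorem lemma2 (R : realType) (delta : R) (u : nat -> R[i]) (a b : nat)
  (hdelta : 0 < delta)
  (hu : exists C : R, 0 < C /\
     forall n : nat, (1 <= n)%N ->
       Normc.normc (u n) <= C * n%:R `^ (1 - delta))
  (ha : (0 < a)%N) (hb : (0 < b)%N) :
  exists (K : R) (N : nat), forall n : nat, (0 < n)%N -> (N <= n)%N ->
    (lne (Normc.normc (hankel_det (dirichlet u) a b n))%:E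
       <= (- (a%:R / 2) * n%:R ^+ 2 * ln n%:R + K * n%:R ^+ 2)%:E)%E.
Proof.
have [C [C_gt0 uC]] := hu.
(* [2 * a%:R] is [a] times the error constant of [sum_sum_ln_ge]; the other term pays for
   [(C * 2) ^+ n], as [n <= n^2]. *)
exists (2 * a%:R + `|ln (C * 2)|), 0%N => n n_gt0 _.
have := norm_hankel_det_le n (fun m => norm_coef_mul_le (ltW hdelta) (ltW C_gt0) uC) ha hb.
set D := Normc.normc _; set V := \prod_(i < n) _ => DV.
(* A vanishing determinant has [lne] equal to minus infinity. *)
rewrite /lne; case: (leP D 0) => [_|D_gt0]; first exact: leNye.
have C2 : 0 < C * 2 by rewrite mulr_gt0.
pose S : R := \sum_(i < n) \sum_(j < n | (i < j)%N) ln i.+1%:R.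
have VE : V = expR (- (a%:R * S)).
  rewrite /S mulr_sumr -sumrN expR_sum; apply: eq_bigr => i _.
  rewrite mulr_sumr -sumrN expR_sum; apply: eq_bigr => j _.
  by rewrite expRN expRM_natl lnK ?posrE ?ltr0n.
have lnD : ln D <= n%:R * ln (C * 2) - a%:R * S.
  rewrite -ler_expR lnK ?posrE// expRD expRM_natl lnK ?posrE//.
  by rewrite -VE.
rewrite lee_fin (le_trans lnD)//.
have n1 : 1 <= n%:R :> R by rewrite ler1n.
have aS := ler_wpM2l (ler0n R a) (sum_sum_ln_ge R n).
have lnC : n%:R * ln (C * 2) <= `|ln (C * 2)| * n%:R ^+ 2.
  rewrite mulrC (le_trans (ler_wpM2r _ (ler_norm _)))//.
  by rewrite ler_wpM2l// expr2 ler_peMr// (le_trans ler01).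
rewrite -/S in aS; lra.
Qed.
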